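(* Let $a\in\mathbb N$ be a multiple of $6$. Then either $f_a\in\mathcal{ID}$, or $f_a\in\mathcal C_3$, in which latter case every essential turning point of $f_a$ is even.
   Context: $\mathbb N=\{1,2,3,\dots\}$. For $a\in\mathbb N$, the function $f_a:\mathbb N\to\mathbb N$ is defined recursively by $f_a(1)=1$, $f_a(2)=a$, and, for each $n\ge 3$, $f_a(n)$ is the smallest positive integer that is not in $\{f_a(1),\dots,f_a(n-1)\}$ and is coprime with $f_a(n-1)$. A turning point of $f=f_a$ is a natural number $t$ such that either (i) $t>3$ and $f(t)-f(t-1)>1$, or (ii) $t=3$ and $f(3)\neq\min(\mathbb N\setminus\{1,a\})$. An essential turning point (ETP) of $f$ is a turning point $t$ such that, in addition: (i) $t>a$ and $f(t)\ne t$; (ii) $f(t-1)=t-2$; (iii) $\{1,2,\dots,t-1\}=\{f(1),f(2),\dots,f(t-1)\}$. $\mathcal C_3$ is the set of all functions $f_b$ that are eventually identical to $f_3$, i.e. such that there exists $m$ with $f_b(n)=f_3(n)$ for all $n>m$. $\mathcal{ID}$ is the set of all functions $f_b$ that are eventually the identity, i.e. such that there exists $m$ with $f_b(n)=n$ for all $n>m$. *)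

(* Defs.v *)
From mathcomp Require Import all_boot.

Set Implicit Arguments.
Unset Strict Implicit.
Unset Printing Implicit Defensive.

(* The positive integers are modelled inside [nat]: indices and values are    *)
(* guarded by [0 < _], and values of sequences at index 0 are never used.     *)

Definition is_least (P : nat -> Prop) (m : nat) : Prop :=
  P m /\ forall k, P k -> m <= k.

(* [s] is a history with the most recent value first.                         *)
Definition admissible (s : seq nat) (m : nat) : bool :=
  [&& 0 < m, m \notin s & coprime (head 0 s) m].

(* The least admissible [m]. The search bound is large enough whenever        *)
(* [head 0 s > 0]: among [k * head 0 s + 1] with [k <= size s], one is not in *)
(* [s] (see [next_least]).                                                    *)
Definition next (s : seq nat) : nat :=
  find (admissible s) (iota 0 (size s * head 0 s).+2).

(* [:: f_a(n); ...; f_a(1)] *)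
Fixpoint hist (a n : nat) : seq nat :=
  match n with
  | 0 => [::]
  | 1 => [:: 1]
  | 2 => [:: a; 1]
  | k.+1 => let s := hist a k in next s :: s
  end.

Definition f (a n : nat) : nat := head 0 (hist a n).

Lemma next_least s : 0 < head 0 s -> is_least (admissible s) (next s).
Proof.
rewrite /next; move defx: (head 0 s) => x x_gt0.
have has_adm : has (admissible s) (iota 0 (size s * x).+2).
  apply/negPn/negP => no_adm.
  pose c := [seq (k * x).+1 | k <- iota 0 (size s).+1].
  have c_uniq : uniq c.
    rewrite map_inj_uniq ?iota_uniq // => k l [] /eqP.
    by rewrite eqn_pmul2r // => /eqP.
  have c_sub : {subset c <= s}.
    move=> m /mapP[k]; rewrite mem_iota add0n ltnS => /andP[_ le_k] ->.
    apply/negPn/negP => kNs; case/hasP: no_adm; exists (k * x).+1.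
      by rewrite mem_iota add0n /= !ltnS leq_mul2r le_k orbT.
    by rewrite /admissible kNs defx /= /coprime -addn1 gcdnMDl gcdn1.
  by have := uniq_leq_size c_uniq c_sub; rewrite size_map size_iota ltnn.
split.
  have := nth_find 0 has_adm; rewrite nth_iota ?add0n //.
  by rewrite -[X in _ < X](size_iota 0) -has_find.
move=> k adm_k; rewrite leqNgt; apply/negP => lt_k.
have := before_find 0 lt_k; rewrite nth_iota ?adm_k //.
by apply: leq_trans lt_k _; rewrite -[X in _ <= X](size_iota 0) find_size.
Qed.

Lemma histS a n : 2 <= n -> hist a n.+1 = next (hist a n) :: hist a n.
Proof. by case: n => [|[|n]]. Qed.

Lemma mem_hist a n m :
  (m \in hist a n) <-> exists2 i, 1 <= i <= n & f a i = m.
Proof.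
elim: n => [|n IHn].
  by split=> // -[i /andP[i_gt0]]; rewrite leqNgt i_gt0.
have -> : hist a n.+1 = f a n.+1 :: hist a n by case: n {IHn} => [|[|n]].
rewrite inE; split=> [/orP[/eqP-> | /IHn[i /andP[i1 i_n] <-]] | [i]].
- by exists n.+1; rewrite ?leqnn.
- by exists i; rewrite // i1 leqW.
case/andP=> i1; rewrite leq_eqVlt => /orP[/eqP-> <- | i_n fi].
  by rewrite eqxx.
by apply/orP; right; apply/IHn; exists i; rewrite // i1.
Qed.

Lemma f1 a : f a 1 = 1.
Proof. by []. Qed.

Lemma f2 a : f a 2 = a.
Proof. by []. Qed.

Lemma f_gt0 a n : 0 < a -> 0 < n -> 0 < f a n.
Proof.
by move=> a_gt0; case: n => [|[|[|n]]].
Qed.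

Lemma f_rec a n : 0 < a -> 3 <= n ->
  is_least (fun m => [/\ 0 < m,
                         ~ (exists2 i, 1 <= i <= n.-1 & f a i = m)
                       & coprime (f a n.-1) m])
           (f a n).
Proof.
case: n => // n a_gt0; rewrite ltnS => n_ge2.
have n_gt0 := ltnW n_ge2.
have [/and3P[m_gt0 mNs co_m] m_min] := next_least (f_gt0 a_gt0 n_gt0).
rewrite [f a n.+1]/f histS //=; split.
  by split=> // /mem_hist mem; rewrite mem in mNs.
move=> k [k_gt0 kNs co_k]; apply: m_min; rewrite /admissible k_gt0 co_k andbT.
by apply/negP => /mem_hist.
Qed.

(* Truncated subtraction is harmless: [1 < x - y] holds iff [x > y + 1].      *)
Definition turning_point (a t : nat) : Prop :=
  (3 < t /\ 1 < f a t - f a t.-1) \/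
  (t = 3 /\ ~ is_least (fun m => [/\ 0 < m, m <> 1 & m <> a]) (f a 3)).

Definition essential_turning_point (a t : nat) : Prop :=
  [/\ turning_point a t,
      a < t /\ f a t <> t,
      f a t.-1 = t.-2
    & [seq f a i | i <- iota 1 t.-1] =i iota 1 t.-1].

(* Only values at positive indices matter for these two families.             *)
Definition in_family (g : nat -> nat) : Prop :=
  exists2 b, 0 < b & forall n, 0 < n -> g n = f b n.

Definition C3 (g : nat -> nat) : Prop :=
  in_family g /\ exists m, forall n, m < n -> g n = f 3 n.

Definition ID (g : nat -> nat) : Prop :=
  in_family g /\ exists m, forall n, m < n -> g n = n.

(* Main.v *)
Require Import Defs.
From mathcomp Require Import all_boot zify.

Set Implicit Arguments.
Unset Strict Implicit.
Unset Printing Implicit Defensive.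

(** Call a history complete up to u.+1 when the values used so far are exactly
    1, ..., u.+1, and suppose that the last of them is an even u. The next value
    is u + g, where g is the least number greater than 1 coprime to u (the least
    prime not dividing u). Every prime below g divides u, so the overshot value
    u + g is coprime to all of u.+1, ..., u + g - 1; the sequence therefore
    returns to u.+2 and climbs through consecutive integers to u + g - 1. This
    is the same situation again, with u replaced by jump u = u + g - 1, which is
    even because g is odd ([reach_jump]). From such a point on, f_a only follows
    the orbit of u under jump.

    Any two jump orbits of positive even numbers meet ([jump_orbits_meet]): the
    same remark about primes below g shows that an orbit entering the interval
    between u and jump u cannot leap over jump u ([jump_nested]), hence lands on
    it. The sequence f_3 starts with 1, 3, 2 and so follows the orbit of 2;
    every f_a that reaches a complete history of this kind thus has the same
    used values and the same last value as f_3 at some index, and coincides with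
    it from there on ([reach_C3]). If instead the last value of a complete
    history is coprime to the least unused number, consecutive integers follow
    forever and f_a is eventually the identity ([reach_ID]).

    For 6 %| a, the sequence also follows a jump orbit at first, the value a
    being the only one used prematurely ([reach_start], [reach_below]), until
    some jump from u to jump u reaches or passes a. If a = u + 2 or a = jump u,
    the history becomes complete when the sequence arrives just below a, and the
    least unused number exceeds the last value by 3; as 3 %| a, neither of the
    two is a multiple of 3, so they are coprime and f_a is eventually the
    identity. Otherwise the climb steps from a - 1 to a + 1, both odd, and the
    history becomes complete at jump u, which gives f_3 ([ID_or_C3]).

    At an odd essential turning point t the last value t - 2 would be coprime to
    the least unused number t, forcing f_a(t) = t, which the definition forbids
    ([etp_even]). *)

(** * The least number coprime to u *)

(** The search succeeds for u > 0 since u.+1 is coprime to u. *)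
Definition gap u := find [pred j | (1 < j) && coprime u j] (iota 0 u.+2).

Lemma gap_le u j : 1 < j -> coprime u j -> gap u <= j.
Proof.
move=> j1 co_j; rewrite leqNgt; apply/negP => lt_j.
have := before_find 0 lt_j; rewrite nth_iota /= ?add0n ?j1 ?co_j //.
by apply: leq_trans lt_j _; rewrite -[X in _ <= X](size_iota 0) find_size.
Qed.

Lemma gapP u : 0 < u -> 1 < gap u /\ coprime u (gap u).
Proof.
move=> u_gt0; pose P := [pred j | (1 < j) && coprime u j].
have hasP : has P (iota 0 u.+2).
  by apply/hasP; exists u.+1; rewrite ?mem_iota /= ?ltnS ?u_gt0 ?coprimenS.
have := nth_find 0 hasP; rewrite nth_iota => [/andP[] //|].
by rewrite -[X in _ < X](size_iota 0) -has_find.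
Qed.

Lemma coprime_add u j : coprime u (u + j) = coprime u j.
Proof. by rewrite /coprime gcdnDl. Qed.

Lemma prime_lt_gap u q : prime q -> q < gap u -> q %| u.
Proof.
move=> q_pr lt_q; apply: contraLR lt_q => qNu.
by rewrite -leqNgt gap_le ?prime_gt1 // coprime_sym prime_coprime.
Qed.

(** A common prime divisor of u + gap u and u + j divides their difference,
    hence is smaller than [gap u] and divides u; but then it divides [gap u]. *)
Lemma coprime_gap_shift u j : 0 < u -> 0 < j < gap u ->
  coprime (u + gap u) (u + j).
Proof.
move=> u_gt0 /andP[j_gt0 lt_j]; have [_ co_u] := gapP u_gt0.
apply: contraLR co_u => co.
pose q := pdiv (gcdn (u + gap u) (u + j)).
have q_pr : prime q.
  rewrite pdiv_prime // ltn_neqAle eq_sym co gcdn_gt0 addn_gt0 u_gt0 //.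
have q1 : q %| u + gap u by apply: dvdn_trans (pdiv_dvd _) (dvdn_gcdl _ _).
have q2 : q %| u + j by apply: dvdn_trans (pdiv_dvd _) (dvdn_gcdr _ _).
have q_le : q <= gap u - j.
  apply: dvdn_leq; first by rewrite subn_gt0.
  by rewrite -(subnDl u) dvdn_sub.
have q_u : q %| u by apply: prime_lt_gap => //; lia.
apply/negP => /(coprime_dvdl q_u).
by rewrite prime_coprime // -(dvdn_addr _ q_u) q1.
Qed.

Lemma odd_gap u : 0 < u -> ~~ odd u -> odd (gap u).
Proof.
move=> u_gt0 u_even; have [_ co] := gapP u_gt0.
rewrite -coprime2n; apply: coprime_dvdl co; by rewrite dvdn2.
Qed.

Lemma odd_gap_ge3 u : 0 < u -> ~~ odd u -> 2 < gap u.
Proof. by move=> u0 ue; have := odd_gap u0 ue; have [] := gapP u0; lia. Qed.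

(** * The jump map *)

(** After a history using exactly 1, ..., u.+1 and ending at u, the next value is
    [u + gap u = (jump u).+1], and [jump u] is the last value of the climb that
    fills the hole left below it. *)
Definition jump u := (u + gap u).-1.

Lemma jumpS u : 0 < u -> (jump u).+1 = u + gap u.
Proof. by rewrite /jump; lia. Qed.

Lemma jump_gt u : 0 < u -> ~~ odd u -> u.+1 < jump u.
Proof. by move=> u0 ue; have := odd_gap_ge3 u0 ue; rewrite /jump; lia. Qed.

Lemma jump_even u : 0 < u -> ~~ odd u -> ~~ odd (jump u).
Proof. by move=> u0 ue; have := odd_gap u0 ue; have := jumpS u0; lia. Qed.

(** No orbit leaps over [jump u] from inside the interval: [(jump u).+1] is
    coprime to every v in it, so it bounds the value that follows v. *)
Lemma jump_nested u v : 0 < u -> ~~ odd u -> ~~ odd v ->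
  u < v < jump u -> jump v <= jump u.
Proof.
move=> u0 ue ve /andP[uv vj].
have je := jump_even u0 ue; have jE := jumpS u0.
suff : gap v <= u + gap u - v by rewrite /jump in vj *; lia.
apply: gap_le; first by lia.
rewrite -coprime_add subnKC; last by lia.
rewrite coprime_sym -(subnKC (ltnW uv)).
by apply: coprime_gap_shift => //; lia.
Qed.

Lemma iter_jump_even k u : 0 < u -> ~~ odd u ->
  0 < iter k jump u /\ ~~ odd (iter k jump u).
Proof.
move=> u0 ue; elim: k => //= k [k0 ke].
by rewrite jump_even //; have := jump_gt k0 ke; lia.
Qed.

Lemma jump_hits u v : 0 < u -> ~~ odd u -> ~~ odd v -> u < v <= jump u ->
  exists l, iter l jump v = jump u.
Proof.
move=> u0 ue; have [d] := ubnP (jump u - v).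
elim: d v => // d IH v lt_d ve /andP[uv].
rewrite leq_eqVlt => /orP[/eqP-> | vj]; first by exists 0.
have v0 : 0 < v by lia.
have jv := jump_gt v0 ve.
have le_j : jump v <= jump u by apply: jump_nested => //; rewrite uv.
have [l <-] : exists l, iter l jump (jump v) = jump u.
  by apply: IH; [lia | exact: jump_even | lia].
by exists l.+1; rewrite iterSr.
Qed.

(** Advance the smaller starting point until it equals v or is about to pass it;
    in the second case the orbit of v lands on the next point. *)
Lemma jump_orbits_meet u v : 0 < u -> ~~ odd u -> 0 < v -> ~~ odd v ->
  exists k l, iter k jump u = iter l jump v.
Proof.
wlog le_uv : u v / u <= v => [th u0 ue v0 ve|].
  have [le|lt] := leqP u v; first exact: th.
  have [k [l e]] : exists k l, iter k jump v = iter l jump u.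
    by apply: th => //; lia.
  by exists l, k.
have [d] := ubnP (v - u).
elim: d u le_uv => // d IH u le_uv lt_d u0 ue v0 ve.
move: le_uv; rewrite leq_eqVlt => /orP[/eqP-> | uv]; first by exists 0, 0.
have ju := jump_gt u0 ue.
have [le|lt] := leqP (jump u) v.
  have [k [l e]] : exists k l, iter k jump (jump u) = iter l jump v.
    by apply: IH => //; [lia | lia | exact: jump_even].
  by exists k.+1, l; rewrite iterSr.
have [l e] : exists l, iter l jump v = jump u.
  by apply: jump_hits => //; rewrite uv ltnW.
by exists 1, l.
Qed.

(** * Histories made of an initial block and a few larger values *)

(** The list Q holds the values used ahead of the initial block 1, ..., x: the
    starting value a, and the value just overshot. *)
Definition stage a n x (Q : seq nat) v :=
  [/\ 1 < n, f a n = v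
    & forall k, (k \in hist a n) = (0 < k <= x) || (k \in Q)].

(** The index is forgotten, since for a complete history it is determined by the
    number of values used ([stage_index]). *)
Definition reach a x Q v := exists n, stage a n x Q v.

Lemma histE a n : hist a n.+1 = f a n.+1 :: hist a n.
Proof. by case: n => [|[|n]]. Qed.

Lemma size_hist a n : size (hist a n) = n.
Proof. by elim: n => // n IH; rewrite histE /= IH. Qed.

Lemma hist_uniq a n : 1 < a -> uniq (hist a n).
Proof.
move=> a1; elim: n => // -[_ //|[_|n IH]].
  by rewrite /= inE andbT; lia.
rewrite histE cons_uniq IH andbT; apply/negP => /mem_hist mem.
by have [[]] := @f_rec a n.+3 (ltnW a1) isT.
Qed.

Lemma stage_eq a n x Q y R v : stage a n x Q v ->
  (forall k, (0 < k <= x) || (k \in Q) = (0 < k <= y) || (k \in R)) ->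
  stage a n y R v.
Proof. by case=> n1 fn memE eqE; split=> // k; rewrite memE. Qed.

Lemma stage_index a n x v : 1 < a -> stage a n x [::] v -> n = x.
Proof.
move=> a1 [_ _ memE]; rewrite -(size_hist a n) -[RHS](size_iota 1).
apply/eqP; rewrite -uniq_size_uniq ?hist_uniq ?iota_uniq // => k.
by rewrite memE in_nil orbF mem_iota; lia.
Qed.

(** A candidate below m is excluded because it lies in the block, in Q, or
    shares a factor with the last value. *)
Lemma stage_next a n x Q v m : 0 < a -> stage a n x Q v ->
    x < m -> m \notin Q -> coprime v m ->
    (forall k, x < k < m -> (k \in Q) || ~~ coprime v k) ->
  stage a n.+1 x (m :: Q) m.
Proof.
move=> a0 [n1 fn memE] xm mNQ co m_min.
suff fE : f a n.+1 = m.
  by split=> [||k]; rewrite ?ltnS ?(ltnW n1) // histE inE fE memE inE orbCA.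
have n2 : 2 < n.+1 by [].
have [[f0 fNh fco] f_min] := @f_rec a n.+1 a0 n2.
move: f0 fNh fco f_min => /=; rewrite fn; move: (f a n.+1) => y y0 yN yco y_min.
apply/eqP; rewrite eqn_leq y_min /=; last first.
  split=> //; first by apply: leq_ltn_trans xm.
  by move/mem_hist; rewrite memE (negPf mNQ); lia.
rewrite leqNgt; apply/negP => ym.
have {}yN : y \notin hist a n by apply/negP => /mem_hist.
move: yN; rewrite memE negb_or y0 /= -ltnNge => /andP[xy yNQ].
by have := m_min y; rewrite xy ym (negPf yNQ) yco => /(_ isT).
Qed.

(** Consecutive integers are coprime, so once the least unused number is
    admissible the sequence climbs until it meets a value already used. *)
Lemma stage_run a n x Q v r : 0 < a -> stage a n x Q v ->
    coprime v x.+1 -> (forall k, x < k <= (x + r).+1 -> k \notin Q) ->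
  stage a (n + r).+1 (x + r).+1 Q (x + r).+1.
Proof.
move=> a0.
have one n' y w : stage a n' y Q w -> coprime w y.+1 -> y.+1 \notin Q ->
    stage a n'.+1 y.+1 Q y.+1.
  move=> st co yNQ; have st' : stage a n'.+1 y (y.+1 :: Q) y.+1.
    by apply: stage_next st _ yNQ co _ => // k; lia.
  by apply: stage_eq st' _ => k; rewrite inE; case: (k \in Q); lia.
elim: r => [|r IH] st co QN.
  by rewrite !addn0 in QN *; apply: one st co (QN _ _); lia.
rewrite !addnS; apply: one (IH st co _) _ (QN _ _); last by lia.
- by move=> k kr; apply: QN; lia.
- exact: coprimenS.
Qed.

Lemma reach_run a x Q v y : 0 < a -> reach a x Q v -> coprime v x.+1 ->
  x < y -> (forall k, x < k <= y -> k \notin Q) -> reach a y Q y.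
Proof.
move=> a0 [n st] co xy QN; exists (n + (y - x.+1)).+1.
have yE : y = (x + (y - x.+1)).+1 by lia.
by rewrite {2 3}yE; apply: stage_run st co _; rewrite // -yE.
Qed.

Lemma reach_eq a x Q y R v : reach a x Q v ->
  (forall k, (0 < k <= x) || (k \in Q) = (0 < k <= y) || (k \in R)) ->
  reach a y R v.
Proof. by case=> n st eqE; exists n; apply: stage_eq st eqE. Qed.

Lemma reach_overshoot a Q u : 0 < a -> 0 < u -> ~~ odd u ->
    reach a u.+1 Q u -> (jump u).+1 \notin Q ->
  reach a u.+1 ((jump u).+1 :: Q) (jump u).+1.
Proof.
move=> a0 u0 ue [n st] jNQ; exists n.+1.
have ju := jump_gt u0 ue; have jE := jumpS u0; have [g1 co] := gapP u0.
apply: stage_next st _ jNQ _ _ => //; first by lia.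
  by rewrite jE coprime_add.
move=> k /andP[uk kj]; apply/orP; right; apply/negP => cok.
suff : gap u <= k - u by lia.
by apply: gap_le; [lia | rewrite -coprime_add subnKC //; lia].
Qed.

Lemma coprime_jump_return u : 0 < u -> ~~ odd u -> coprime (jump u).+1 u.+2.
Proof.
move=> u0 ue; rewrite jumpS // -addn2; apply: coprime_gap_shift => //.
by rewrite odd_gap_ge3.
Qed.

(** The overshot value [(jump u).+1] is coprime to the least unused number u.+2
    ([coprime_jump_return]), so the climb fills the hole below it and then the
    block absorbs it. *)
Lemma reach_jump a Q u : 0 < a -> 0 < u -> ~~ odd u -> reach a u.+1 Q u ->
    (forall k, u.+1 < k <= (jump u).+1 -> k \notin Q) ->
  reach a (jump u).+1 Q (jump u).
Proof.
move=> a0 u0 ue st QN; have ju := jump_gt u0 ue.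
have st1 : reach a u.+1 ((jump u).+1 :: Q) (jump u).+1.
  by apply: reach_overshoot => //; apply: QN; lia.
have st2 : reach a (jump u) ((jump u).+1 :: Q) (jump u).
  apply: reach_run st1 _ ju _ => //; first exact: coprime_jump_return.
  by move=> k kj; rewrite inE negb_or QN ?andbT; lia.
by apply: reach_eq st2 _ => k; rewrite inE; case: (k \in Q); lia.
Qed.

(** * Membership in the two families *)

(** The climb from a complete history never meets a used value; as the history
    is complete at index x, it takes the value i at every later index i. *)
Lemma reach_ID a x v : 1 < a -> reach a x [::] v -> coprime v x.+1 -> ID (f a).
Proof.
move=> a1 [n st] co; split; first by exists a => //; apply: ltnW.
exists n => m nm; have nE := stage_index a1 st; rewrite -nE in st co.
have [_ fE _] := @stage_run a n n [::] v (m - n.+1) (ltnW a1) st co (fun _ _ => isT).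
by rewrite (_ : m = (n + (m - n.+1)).+1) //; lia.
Qed.

(** The recursion depends on the past only through the set of used values and
    the last value. *)
Lemma f_tail_eq a b n : 1 < n -> hist a n =i hist b n -> f a n = f b n ->
  forall m, n <= m -> f a m = f b m.
Proof.
move=> n1 memE fE m nm; rewrite -(subnKC nm); move: (m - n) => d {m nm}.
suff [] : hist a (n + d) =i hist b (n + d) /\ f a (n + d) = f b (n + d) by [].
elim: d => [|d [IHm IHf]]; rewrite ?addn0 // addnS.
have nd : 1 < n + d by rewrite ltn_addr.
have nextE : f a (n + d).+1 = f b (n + d).+1.
  rewrite /f !histS //= /Defs.next !size_hist.
  rewrite -!/(f _ _) IHf; apply: eq_find => k.
  by rewrite /admissible IHm -!/(f _ _) IHf.
by split=> // k; rewrite !histE !inE nextE IHm.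
Qed.

Lemma reach_iter_jump a u k : 0 < a -> 0 < u -> ~~ odd u ->
  reach a u.+1 [::] u -> reach a (iter k jump u).+1 [::] (iter k jump u).
Proof.
move=> a0 u0 ue st; elim: k => //= k IH.
by have [k0 ke] := iter_jump_even k u0 ue; apply: reach_jump.
Qed.

(** Both f_a and f_3 pass through a common point w of the two orbits with the
    used values 1, ..., w.+1, hence also at the same index. *)
Lemma reach_C3 a u : 1 < a -> 0 < u -> ~~ odd u -> reach a u.+1 [::] u ->
  C3 (f a).
Proof.
move=> a1 u0 ue st; split; first by exists a => //; apply: ltnW.
(* The first three values of f_3 are 1, 3, 2. *)
have st3 : reach 3 3 [::] 2.
  by exists 3; split=> // -[|[|[|[|k]]]].
have [k [l kl]] := @jump_orbits_meet u 2 u0 ue isT isT.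
have [n sta] := reach_iter_jump k (ltnW a1) u0 ue st.
have [n' stb] := @reach_iter_jump 3 2 l isT isT isT st3.
rewrite -kl in stb.
have nE := stage_index a1 sta; have n'E := @stage_index 3 _ _ _ isT stb.
rewrite n'E -nE in stb; have [n1 fa ma] := sta; have [_ fb mb] := stb.
exists n => m /ltnW; apply: f_tail_eq => //; last by rewrite fa fb.
by move=> j; rewrite ma mb -nE.
Qed.

(** * Absorbing the initial value *)

(** From the even value a, the sequence goes to [gap a], which is odd, then back
    to 2 and up to [(gap a).-1]; and a.-1 is coprime to a, so all this happens
    below a. *)
Lemma reach_start a : 2 < a -> ~~ odd a ->
  [/\ 1 < gap a, gap a < a & reach a (gap a) [:: a] (gap a).-1].
Proof.
move=> a2 ae; have a0 : 0 < a by lia.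
have [g1 co] := gapP a0; have g3 := odd_gap_ge3 a0 ae; have go := odd_gap a0 ae.
have ga : gap a < a.
  suff : gap a <= a.-1 by lia.
  by apply: gap_le; [lia | rewrite coprimenP].
split=> //.
have st2 : stage a 2 1 [:: a] a.
  by split=> // k; rewrite !inE orbC; congr (_ || _); lia.
have st3 : reach a 1 [:: gap a; a] (gap a).
  exists 3; apply: stage_next st2 _ _ co _ => //.
    by rewrite inE; lia.
  move=> k /andP[k1 kg]; apply/orP; right; apply/negP => cok.
  by have := gap_le k1 cok; lia.
have st4 : reach a (gap a).-1 [:: gap a; a] (gap a).-1.
  apply: reach_run st3 _ _ _ => //; first by rewrite coprimen2.
  by move=> k; rewrite !inE; lia.
by apply: reach_eq st4 _ => k; rewrite !inE; lia.
Qed.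

(** As [jump u] and a are both even, [jump u < a] leaves room for the overshot
    value [(jump u).+1] below a, so the jump is not disturbed by a. The point w
    is the last one whose jump does not stay below a. *)
Lemma reach_below a u : 0 < a -> ~~ odd a -> 0 < u -> ~~ odd u -> u.+1 < a ->
    reach a u.+1 [:: a] u ->
  exists w, [/\ 0 < w, ~~ odd w, w.+1 < a <= jump w & reach a w.+1 [:: a] w].
Proof.
move=> a0 ae; have [d] := ubnP (a - u).
elim: d u => // d IH u lt_d u0 ue ua st.
have [le|lt] := leqP a (jump u); first by exists u; rewrite ua le.
have ju := jump_gt u0 ue; have je := jump_even u0 ue.
apply: (IH (jump u)) => //; try lia.
by apply: reach_jump => // k; rewrite inE; lia.
Qed.

Lemma ID_or_C3 a : 0 < a -> 6 %| a -> ID (f a) \/ C3 (f a).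
Proof.
move=> a0 a6; have a1 : 1 < a by lia.
have ae : ~~ odd a by lia.
have [g1 ga st0] := @reach_start a ltac:(lia) ae.
have go := odd_gap a0 ae.
have [||||u [u0 ue /andP[ua aj] st]] := @reach_below a (gap a).-1 a0 ae.
- by lia.
- by lia.
- by lia.
- by rewrite prednK //; lia.
have ju := jump_gt u0 ue; have je := jump_even u0 ue.
(* If a = u + 2, the least unused number is u + 3, and u is not a multiple of 3
   because a is. *)
have [u2|a2] := eqVneq a u.+2.
  left; apply: (@reach_ID a u.+2 u) => //.
    by apply: reach_eq st _ => k; rewrite !(inE, in_nil); lia.
  rewrite -addn3 coprime_add coprime_sym prime_coprime //; lia.
have st1 : reach a u.+1 [:: (jump u).+1; a] (jump u).+1.
  by apply: reach_overshoot => //; rewrite inE; lia.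
have st2 : reach a a.-1 [:: (jump u).+1; a] a.-1.
  apply: reach_run st1 _ _ _ => //; first exact: coprime_jump_return.
    by lia.
  by move=> k; rewrite !inE; lia.
(* If a = jump u, the overshot value is a.+1, and the climb stops at a.-1 with
   a.+2 as least unused number; 3 divides neither of them. *)
have [ja|ja] := eqVneq a (jump u).
  left; apply: (@reach_ID a a.+1 a.-1) => //.
    by apply: reach_eq st2 _ => k; rewrite !(inE, in_nil) -ja; lia.
  rewrite (_ : a.+2 = a.-1 + 3) ?coprime_add 1?coprime_sym ?prime_coprime //; lia.
right; apply: (@reach_C3 a (jump u)) => //; first by lia.
(* The climb steps over a: a.-1 and a.+1 are odd and differ by 2. *)
have st3 : reach a a [:: (jump u).+1] a.-1.
  by apply: reach_eq st2 _ => k; rewrite !inE; lia.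
have st4 : reach a (jump u) [:: (jump u).+1] (jump u).
  apply: reach_run st3 _ _ _ => //.
  - rewrite (_ : a.+1 = a.-1 + 2) ?coprime_add ?coprimen2; lia.
  - by lia.
  - by move=> k; rewrite !inE; lia.
by apply: reach_eq st4 _ => k; rewrite !(inE, in_nil); lia.
Qed.

(** With t odd, t - 2 and t are coprime, and t is the least unused number. *)
Lemma etp_even a t : 1 < a -> essential_turning_point a t -> ~~ odd t.
Proof.
move=> a1 [_ [lt_at ft] fp memE]; apply/negP => t_odd; apply: ft.
have st : stage a t.-1 t.-1 [::] t.-2.
  split=> //; first by lia.
  move=> k; have -> : (k \in hist a t.-1) = (k \in iota 1 t.-1).
    rewrite -memE; apply/idP/mapP => [/mem_hist[i it <-]|[i it ->]].
      by exists i => //; rewrite mem_iota; lia.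
    by apply/mem_hist; exists i => //; rewrite mem_iota in it; lia.
  by rewrite mem_iota in_nil; lia.
have co : coprime t.-2 t.-1.+1.
  rewrite (_ : t.-1.+1 = t.-2 + 2) ?coprime_add ?coprimen2; lia.
have [_ fE _] := stage_run (r := 0) (ltnW a1) st co (fun _ _ => isT).
by rewrite !addn0 prednK in fE; lia.
Qed.

Theorem theorem2p5 (a : nat) (a_gt0 : 0 < a) (a_mul6 : 6 %| a) :
  (ID (f a) \/ C3 (f a)) /\
  (C3 (f a) -> forall t, essential_turning_point a t -> ~~ odd t).
Proof.
split; first exact: ID_or_C3.
by move=> _ t; apply: etp_even; lia.
Qed.
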